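(* Let $q$ be a power of an odd prime, let $\lambda\in\mathbb{F}_q$ be a non-square, and let $f=Xw(X^2)+a\in\mathbb{F}_q[X]$ with $w\in\mathbb{F}_q[X]$ and $a\in\mathbb{F}_q^*$ be a permutation polynomial of $\mathbb{F}_q$. Then: (i) every directed path of Type 1 in $\mathcal{G}(\lambda,f)$ contains at most $\lfloor\frac{3}{4}q+\frac{17}{4}\rfloor$ vertices; (ii) if moreover $q>17$ and $\mathcal{G}(\lambda,f)$ is connected, then $\mathcal{G}(\lambda,f)$ has no Hamiltonian cycle of Type 1.
   Context: For a polynomial $f\in\mathbb{F}_q[X]$ and a non-square $\lambda\in\mathbb{F}_q$, $\mathcal{G}(\lambda,f)$ is the directed graph with vertex set $\mathbb{F}_q$ and an edge from $x$ to $y$ iff $(y^2-f(x))(\lambda y^2-f(x))=0$ (loops allowed); connected means weakly connected; paths have distinct vertices. Weights: an edge $(x,y)$ has weight $0$ if $y^2=f(x)$ and weight $1$ otherwise (so the edge into vertex $0$ has weight $0$). A trail is a directed path all of whose edges have the same weight; its length is its number of edges. A directed path is of Type $n$ if it contains a trail of length $n$ but no trail of length greater than $n$. A Hamiltonian cycle $H$ of a connected component is of Type $n$ if $H\setminus\{0\}$ (the cycle with vertex $0$ and its incident edges removed) is a path of Type $n$. *)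

(* Defs.v *)
From mathcomp Require Import all_boot all_algebra.
Set Implicit Arguments.
Unset Strict Implicit.
Unset Printing Implicit Defensive.
Import GRing.Theory.
Local Open Scope ring_scope.

Definition is_square (F : finFieldType) (c : F) : Prop := exists b : F, c = b ^+ 2.

Definition permutation_polynomial (F : finFieldType) (f : {poly F}) : Prop :=
  bijective (fun x : F => f.[x]).

Definition edge (F : finFieldType) (lam : F) (f : {poly F}) : rel F :=
  [rel x y | (y ^+ 2 - f.[x]) * (lam * y ^+ 2 - f.[x]) == 0].

Definition weakly_connected (F : finFieldType) (lam : F) (f : {poly F}) : Prop :=
  forall x y : F,
    connect [rel u v | edge lam f u v || edge lam f v u] x y.

Definition weight (F : finFieldType) (f : {poly F}) (x y : F) : nat :=
  if y ^+ 2 == f.[x] then 0%N else 1%N.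

(* A directed path is represented by the nonempty sequence of its vertices, in
   order; a single vertex is a path without edges. *)
Definition directed_path (F : finFieldType) (lam : F) (f : {poly F})
    (p : seq F) : Prop :=
  [/\ p <> [::], uniq p & sorted (edge lam f) p].

Definition path_length (F : finFieldType) (p : seq F) : nat := (size p).-1.

Definition trail (F : finFieldType) (lam : F) (f : {poly F})
    (t : seq F) : Prop :=
  directed_path lam f t /\
  exists k : nat, sorted [rel x y | weight f x y == k] t.

(* As the vertices of p are distinct, the directed paths contained in p (using
   its vertices and edges) are exactly its nonempty contiguous subsequences. *)
Definition path_of_type (F : finFieldType) (lam : F) (f : {poly F})
    (n : nat) (p : seq F) : Prop :=
  [/\ directed_path lam f p,
      exists t : seq F, [/\ infix t p, trail lam f t & path_length t = n]
    & forall t : seq F, infix t p -> trail lam f t -> (path_length t <= n)%N].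

Definition hamiltonian_cycle (F : finFieldType) (lam : F) (f : {poly F})
    (C : {set F}) (c : seq F) : Prop :=
  ucycle (edge lam f) c /\ c =i C.

(* Rotating the cycle c so that it starts at 0 and dropping 0 leaves the
   vertices of c \ {0} in path order, from the successor of 0 to its
   predecessor. *)
Definition cycle_of_type (F : finFieldType) (lam : F) (f : {poly F})
    (n : nat) (c : seq F) : Prop :=
  (0 : F) \in c /\ path_of_type lam f n (behead (rot (index 0 c) c)).

(* Main.v *)
Require Import Defs.
From mathcomp Require Import all_boot all_algebra.
From mathcomp Require Import zify ring.
Import GRing.Theory.
Local Open Scope ring_scope.

(** The symmetry f(y) + f(-y) = 2a drives the proof. For y <> 0 the vertices y
   and -y have the same two in-neighbours, one emitting edges of weight 0 and
   the other edges of weight 1. If y and -y are both interior vertices of a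
   path of Type 1, they are therefore entered, hence also left, by edges of
   different weights, so f(y) / f(-y) is not a nonzero square. Solving
   f(y) = r^2 f(-y) gives f(y) = 2 a r^2 / (r^2 + 1), which by bijectivity of f
   has about q/2 solutions y; the path misses a vertex of each such pair
   {y, -y}, up to the two pairs of its endpoints. *)

(** Translation by 1 permutes [F], so summing over [F] gives [#|F| * 1 = 0]; with [#|F|] odd,
    [2 = 0] would turn this into [1 = 0]. *)
Lemma odd_card_two_neq0 (F : finFieldType) : odd #|F| -> (2 : F) != 0.
Proof.
move=> hodd; apply/eqP => h2.
have : \sum_(x : F) (1 + x) = \sum_(x : F) x.
  by rewrite [RHS](reindex_inj (addrI 1)).
rewrite big_split /= -[RHS]add0r => /addIr /eqP.
rewrite sumr_const -(odd_double_half #|F|) hodd mulrnDr -muln2 mulnC mulrnA.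
by rewrite h2 mul0rn addr0 oner_eq0.
Qed.

Lemma opp_neq (F : fieldType) (y : F) : (2 : F) != 0 -> y != 0 -> - y <> y.
Proof.
move=> h2 y0 e; have /eqP : 2 * y = 0 by rewrite mulr_natl mulr2n -{1}e addNr.
by rewrite mulf_eq0 (negPf h2) (negPf y0).
Qed.

Lemma leq_card_fibers (I J : finType) (h : I -> J) (A : {set I}) (n : nat) :
  (forall x, x \in A -> (#|[set y in A | h y == h x]| <= n)%N) ->
  (#|A| <= n * #|[set h x | x in A]|)%N.
Proof.
move=> hn; rewrite -sum1_card (partition_big_imset h) /= mulnC -sum_nat_const.
apply: leq_sum => _ /imsetP [x xA ->].
apply: leq_trans (hn x xA); rewrite -sum1_card.
by under [X in (_ <= X)%N]eq_bigl do rewrite inE.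
Qed.

Lemma card_sqr_eq (F : finFieldType) (c : F) :
  (#|[set r : F | r ^+ 2 == c]| <= 2)%N.
Proof.
have [->|[s]] := set_0Vmem [set r : F | r ^+ 2 == c]; first by rewrite cards0.
rewrite inE => /eqP <-.
apply: leq_trans (_ : #|[set s; - s]| <= 2)%N; last first.
  by rewrite cards2; case: eqP.
by apply/subset_leq_card/subsetP => r; rewrite !inE eqf_sqr.
Qed.

(** Two consecutive edges of equal weight would form a trail of length 2. *)
Lemma path_type1_weight_neq (F : finFieldType) (lam : F) (f : {poly F})
    (p : seq F) (i : nat) :
  path_of_type lam f 1 p -> (i.+2 < size p)%N ->
  weight f p`_i p`_i.+1 <> weight f p`_i.+1 p`_i.+2.
Proof.
move=> [[_ up sp] _ hmax] hi e.
have it : infix [:: p`_i; p`_i.+1; p`_i.+2] p.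
  have -> : [:: p`_i; p`_i.+1; p`_i.+2] = take 3 (drop i p).
    by do 3! [rewrite (drop_nth 0) /=; last lia]; rewrite take0.
  exact: infix_trans (infix_take _ _) (infix_drop _ _).
suff : (2 <= 1)%N by [].
apply: (hmax _ it); split.
  by split; [|exact: infix_uniq it up|exact: infix_sorted it sp].
by exists (weight f p`_i p`_i.+1); rewrite /= eqxx e eqxx.
Qed.

Lemma edge_weight (F : finFieldType) (lam : F) (f : {poly F}) (x y : F) :
  edge lam f x y ->
  f.[x] = if weight f x y == 0%N then y ^+ 2 else lam * y ^+ 2.
Proof.
rewrite /edge /weight /= mulf_eq0 !subr_eq0.
by have [-> //|_ /= /eqP ->] := eqVneq (y ^+ 2) f.[x].
Qed.

(** Writing the index as [i.+1] gives access to both the predecessor and the successor on the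
    path. *)
Lemma interior_vertex (T : eqType) (x0 y : T) (p : seq T) :
  y \in p -> y != head x0 p -> y != last x0 p ->
  exists i, (i.+2 < size p)%N /\ nth x0 p i.+1 = y.
Proof.
move=> yp; rewrite -nth0 -nth_last; have := yp; rewrite -index_mem.
case e: (index y p) => [|i] hi.
  by rewrite -e nth_index ?eqxx.
move=> _ hl; exists i; split; last by rewrite -e nth_index.
have hs : i.+2 != size p.
  by apply: contra hl => /eqP <-; rewrite /= -e nth_index.
lia.
Qed.

Section Pairs.

Variables (F : finFieldType) (lam : F) (f : {poly F}) (p : seq F).
Hypothesis two_neq0 : (2 : F) != 0.
Hypothesis lam_nsq : ~ is_square lam.
Hypothesis f_inj : injective (fun x : F => f.[x]).
Hypothesis p_type1 : path_of_type lam f 1 p.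

Lemma opp_pair_not_interior (y r : F) :
  y != 0 -> r != 0 -> f.[- y] != 0 -> f.[y] = r ^+ 2 * f.[- y] ->
  y \in p -> y != head 0 p -> y != last 0 p ->
  - y \in p -> - y != head 0 p -> - y != last 0 p -> False.
Proof.
move=> y0 r0 fNy0 hr yp yh yl Nyp Nyh Nyl.
have [[_ up /(sortedP 0) sp] _ _] := p_type1.
have [i [hi ei]] := interior_vertex _ 0 _ _ yp yh yl.
have [j [hj ej]] := interior_vertex _ 0 _ _ Nyp Nyh Nyl.
have fy0 : f.[y] != 0 by rewrite hr mulf_neq0 // expf_neq0.
have ni := path_type1_weight_neq _ _ _ _ _ p_type1 hi.
have nj := path_type1_weight_neq _ _ _ _ _ p_type1 hj.
have si := edge_weight _ _ _ _ _ (sp i (ltnW hi)).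
have sj := edge_weight _ _ _ _ _ (sp j (ltnW hj)).
have ti := edge_weight _ _ _ _ _ (sp i.+1 hi).
have tj := edge_weight _ _ _ _ _ (sp j.+1 hj).
rewrite ei in ni si ti; rewrite ej sqrrN in nj sj tj.
have ij : p`_i <> p`_j.
  move=> /eqP.
  rewrite (nth_uniq 0 (ltnW (ltnW hi)) (ltnW (ltnW hj)) up) => /eqP ij.
  by apply: (opp_neq _ y two_neq0 y0); rewrite -ej -ij ei.
have nsq (b c : F) : lam * b ^+ 2 = c ^+ 2 -> b != 0 -> False.
  move=> e b0; apply: lam_nsq; exists (c / b).
  by rewrite expr_div_n -e mulfK // expf_neq0.
move: ni nj si sj ti tj; rewrite /weight.
case: ifP => _; case: ifP => _ // _;
  case: ifP => _; case: ifP => _ // _ /= si sj ti tj.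
(* If [y] and [- y] are entered with equal weights, their predecessors have the same image under
   [f], hence coincide. *)
all: try by [apply: ij; apply: f_inj; rewrite /= si sj].
(* In the two remaining cases one of [f.[y]], [f.[- y]] is a square and the other [lam] times a
   square; since their ratio is [r ^+ 2], [lam] would be a square. *)
- apply: (nsq p`_i.+2 (r * p`_j.+2)).
    by rewrite -ti /= hr tj /= exprMn.
  by apply: contra fy0 => /eqP e; rewrite ti e expr0n mulr0.
- apply: (nsq (r * p`_j.+2) p`_i.+2).
    by rewrite -ti /= hr tj /= exprMn; ring.
  rewrite mulf_neq0 //.
  by apply: contra fNy0 => /eqP e; rewrite tj e expr0n mulr0.
Qed.

End Pairs.

Section Count.

Variables (F : finFieldType) (f : {poly F}) (a : F).
Hypothesis two_neq0 : (2 : F) != 0.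
Hypothesis a_neq0 : a != 0.
Hypothesis f_bij : bijective (fun x : F => f.[x]).
Hypothesis f_sym : forall y : F, f.[y] + f.[- y] = 2 * a.

Definition square_ratio : {set F} :=
  [set y | (f.[- y] != 0) &&
    [exists r, (r != 0) && (f.[y] == r ^+ 2 * f.[- y])]].

Lemma card_square_ratio : (#|F| <= 2 * #|square_ratio| + 3)%N.
Proof.
have [g fK gK] := f_bij.
(* Only 0 and the at most two square roots of -1 are left out, whence the constant 3. *)
set R := [set r : F | (r != 0) && (r ^+ 2 != -1)].
pose phi r := g (2 * a * r ^+ 2 / (r ^+ 2 + 1)).
have den r : r \in R -> r ^+ 2 + 1 != 0.
  by rewrite inE addr_eq0 => /andP [].
have hf r : f.[phi r] = 2 * a * r ^+ 2 / (r ^+ 2 + 1) by rewrite [LHS]gK.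
have hfN r : r \in R -> f.[- phi r] = 2 * a / (r ^+ 2 + 1).
  move=> /den d; have -> : f.[- phi r] = 2 * a - f.[phi r].
    by rewrite -(f_sym (phi r)); ring.
  by rewrite hf; field.
have h2a : 2 * a != 0 by rewrite mulf_neq0.
have sub : [set phi r | r in R] \subset square_ratio.
  apply/subsetP => _ /imsetP [r rR ->]; have d := den r rR; rewrite inE hfN //.
  rewrite mulf_neq0 ?invr_neq0 //=; apply/existsP; exists r.
  have := rR; rewrite inE => /andP [-> _] /=.
  by rewrite hf; apply/eqP; field.
(* [phi] is at most two-to-one: the value [2 * a / (r ^+ 2 + 1)] of [f] at [- phi r] determines
   [r ^+ 2]. *)
have cR : (#|R| <= 2 * #|[set phi r | r in R]|)%N.
  apply: leq_card_fibers => x xR; apply: leq_trans (card_sqr_eq _ (x ^+ 2)).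
  apply/subset_leq_card/subsetP => r; rewrite !inE => /andP [rR /eqP e].
  have {}rR : r \in R by rewrite inE.
  have := hfN r rR; rewrite e hfN // => /(mulfI h2a) /invr_inj /addIr ->.
  by [].
have cC : (#|~: R| <= 3)%N.
  apply: leq_trans (_ : #|0%R |: [set r : F | r ^+ 2 == -1]%R| <= 3)%N.
    by apply/subset_leq_card/subsetP => r; rewrite !inE negb_and !negbK.
  rewrite cardsU1; exact: leq_add (leq_b1 _) (card_sqr_eq F (-1)).
rewrite -(cardsC R) leq_add // (leq_trans cR) // leq_mul2l.
exact: subset_leq_card sub.
Qed.

(* The constant 13, sharper than the 17 of part (i), is what excludes a path
   through all q - 1 nonzero vertices when q = 19. *)
Lemma card_path_type1 (lam : F) (p : seq F) :
  ~ is_square lam -> path_of_type lam f 1 p -> (4 * size p <= 3 * #|F| + 13)%N.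
Proof.
move=> lam_nsq p_type1; have [[_ up _] _ _] := p_type1.
(* The vertices that are not interior to the path: those it misses and its endpoints. *)
set M := [set y | y \notin p] :|: [set head 0 p; last 0 p].
(* 0 lies in [square_ratio] (take [r = 1]) but is its own opposite, so it is set apart. *)
have sub : square_ratio \subset 0 |: (M :|: [set - y | y in M]).
  apply/subsetP => y; rewrite in_setU1 in_setU inE => /andP [fNy0].
  move=> /existsP [r /andP [r0 /eqP hr]].
  have [->//|y0 /=] := eqVneq y 0.
  have -> : (y \in [set - x | x in M]) = (- y \in M).
    by rewrite -{1}[y]opprK (mem_imset _ _ oppr_inj).
  apply/orP; case: (boolP (y \in M)) => [|yM]; first by left.
  case: (boolP (- y \in M)) => [|NyM]; first by right.
  move: yM NyM; rewrite !inE !negb_or !negbK.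
  move=> /and3P [yp yh yl] /and3P [Nyp Nyh Nyl]; exfalso.
  apply: (opp_pair_not_interior _ lam f p _ _ _ _ y r) => //.
  exact: bij_inj.
have cM : (#|M| <= #|F| - size p + 2)%N.
  apply: leq_trans (leq_card_setU _ _) _; apply: leq_add; last first.
    by rewrite cards2; case: eqP.
  rewrite -(card_uniqP up) -(cardC (mem p)) addKn.
  by apply/subset_leq_card/subsetP => y; rewrite !inE.
have sp : (size p <= #|F|)%N by rewrite -(card_uniqP up) max_card.
have cB : (#|square_ratio| <= 1 + 2 * #|M|)%N.
  apply: leq_trans (subset_leq_card sub) _.
  apply: leq_trans (leq_card_setU _ _) _; rewrite cards1 leq_add2l mul2n -addnn.
  by apply: leq_trans (leq_card_setU _ _) _; rewrite leq_add2l leq_imset_card.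
(* With [q = #|F|] and [s = size p], [q <= 2 * (1 + 2 * (q - s + 2)) + 3 = 4 * q - 4 * s + 13]. *)
have := card_square_ratio; lia.
Qed.

End Count.

Theorem theorem2p11 (F : finFieldType) (hodd : odd #|F|)
    (lam : F) (hlam : ~ is_square lam)
    (f w : {poly F}) (a : F) (ha : a != 0)
    (hf : f = 'X * (w \Po 'X^2) + a%:P)
    (hperm : permutation_polynomial f) :
  (forall p : seq F, path_of_type lam f 1 p ->
     (size p <= (3 * #|F| + 17) %/ 4)%N) /\
  ((17 < #|F|)%N -> weakly_connected lam f ->
     ~ exists c : seq F,
         hamiltonian_cycle lam f [set: F] c /\ cycle_of_type lam f 1 c).
Proof.
have h2 := odd_card_two_neq0 _ hodd.
have f_sym y : f.[y] + f.[- y] = 2 * a.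
  (* The part ['X * (w \Po 'X^2)] is odd and cancels. *)
  by rewrite hf !hornerE !horner_comp !hornerE sqrrN /=; ring.
have bound p := card_path_type1 _ _ _ h2 ha hperm f_sym _ p hlam.
split=> [p /bound|q17 _ [c [[/andP [_ uc] cF] [c0 /bound]]]]; first by lia.
have sc : size c = #|F| by rewrite -(card_uniqP uc) -cardsT; apply: eq_card.
(* Without 0 the cycle is a path on [q - 1] vertices, and [4 * (q - 1) <= 3 * q + 13] forces
   [q <= 17]. *)
rewrite size_behead size_rot sc; lia.
Qed.
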